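(* Let $t\in\mathbb{Z}_+$ and $\alpha\in(0,1)$. Let $\mathcal{Q}_1,\dots,\mathcal{Q}_t$ be probability distributions on $\mathbb{R}$ with continuous CDFs $F_1,\dots,F_t$. Let $\mathcal{D}_1,\dots,\mathcal{D}_t$ be independent datasets, where $\mathcal{D}_j=\{u_{j,i}\}_{i=1}^{B_j}$ consists of $B_j\ge 1$ i.i.d. samples from $\mathcal{Q}_j$. Suppose $1\le i\le k\le t$ and $\delta\in(0,1)$. Then with probability at least $1-\delta$, $$\big|\widehat{F}_{t,i}(\widehat{q}_{t,k})-(1-\alpha)\big|\le \frac{12}{5}\phi(t,k)+\frac{6}{5}\psi(t,k,\delta/2)+\frac{4}{5}\psi(t,i,\delta/2).$$
   Context: For a CDF $F$ and $\gamma\in(0,1)$, the left $\gamma$-quantile is $\mathsf{Q}^-_\gamma(F)=\inf\{x\in\mathbb{R}:F(x)\ge\gamma\}$. For $m\in\{1,\dots,t\}$ let $B_{t,m}=\sum_{j=t-m+1}^t B_j$ and $\widehat{F}_{t,m}(x)=\frac{1}{B_{t,m}}\sum_{j=t-m+1}^t\sum_{l=1}^{B_j}\mathbf{1}\{x\ge u_{j,l}\}$. Define $\widehat{q}_{t,m}=\mathsf{Q}^-_{1-\alpha}(\widehat{F}_{t,m})$, $\phi(t,m)=\max_{t-m+1\le j\le t}\|F_j-F_t\|_\infty$, and $\psi(t,m,\delta)=\frac{5}{4}\sqrt{\frac{2\alpha(1-\alpha)\log(2/\delta)}{B_{t,m}}}+\frac{4\log(2/\delta)}{B_{t,m}}$.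 *)

(* Defs.v *)
From HB Require Import structures.
From mathcomp Require Import all_boot all_order all_algebra.
From mathcomp Require Import all_classical all_reals all_analysis.
Set Implicit Arguments. Unset Strict Implicit. Unset Printing Implicit Defensive.
Import Order.TTheory GRing.Theory Num.Theory.
Import numFieldNormedType.Exports.
Local Open Scope classical_set_scope.
Local Open Scope ring_scope.

Definition mutually_independent d (T : measurableType d) (R : realType)
  (P : probability T R) (I : eqType) (D : set I) (X : I -> T -> R) : Prop :=
  forall (s : seq I) (A : I -> set R),
    uniq s -> (forall i, i \in s -> D i) ->
    (forall i, measurable (A i)) ->
    P (\big[setI/setT]_(i <- s) (X i @^-1` A i)) =
    (\prod_(i <- s) P (X i @^-1` A i))%E.

Definition Qminus (R : realType) (gamma : R) (F : R -> R) : R :=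
  inf [set x : R | gamma <= F x].

Definition Bsum (B : nat -> nat) (t m : nat) : nat :=
  (\sum_((t - m).+1 <= j < t.+1) B j)%N.

Definition Fhat (R : realType) (T : Type) (B : nat -> nat)
  (u : nat -> nat -> T -> R) (t m : nat) (x : R) (w : T) : R :=
  ((Bsum B t m)%:R)^-1 *
  \sum_((t - m).+1 <= j < t.+1) \sum_(1 <= l < (B j).+1)
      (if u j l w <= x then 1 else 0).

Definition qhat (R : realType) (T : Type) (alpha : R) (B : nat -> nat)
  (u : nat -> nat -> T -> R) (t m : nat) (w : T) : R :=
  Qminus (1 - alpha) (fun x => Fhat B u t m x w).

Definition supnorm (R : realType) (f : R -> R) : R :=
  sup [set `|f x| | x in [set: R]].

Definition phi (R : realType) (F : nat -> R -> R) (t m : nat) : R :=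
  \big[Num.max/0]_((t - m).+1 <= j < t.+1) supnorm (fun x => F j x - F t x).

Definition psi (R : realType) (alpha : R) (B : nat -> nat) (t m : nat)
  (delta : R) : R :=
  5 / 4 * Num.sqrt (2 * alpha * (1 - alpha) * ln (2 / delta) / (Bsum B t m)%:R)
  + 4 * ln (2 / delta) / (Bsum B t m)%:R.

(* Main.v *)
(* The random point [qhat] is trapped between two deterministic points.  Let
   [e = psi t k (delta/2)] and pick [x1], [x2] where the mean [Fbar] of the
   empirical CDF over the window [k] equals [1 - alpha - e] and [1 - alpha + e].
   Two Bernstein bounds, each failing with probability at most [delta/4], give
   [Fhat_k x1 < 1 - alpha < Fhat_k x2], hence [x1 <= qhat <= x2]; two more control
   [Fhat_i x1] and [Fhat_i x2], and [Fhat_i] is monotone.  If [x1] or [x2] does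
   not exist, the corresponding inequality follows from [0 <= Fhat_i <= 1].
   If [|Fbar - (1 - alpha)| <= D], Bernstein with variance at most
   [alpha (1 - alpha) + D] bounds the deviation by [D / 5 + 4 / 5 psi]: taking
   [D = e] this is exactly [e] for the window [k], and taking [D = e + 2 phi] it
   gives the stated constants for the window [i]. *)
Require Import Defs.
From HB Require Import structures.
From mathcomp Require Import all_boot all_order all_algebra.
From mathcomp Require Import all_classical all_reals all_analysis measurable_realfun.
From mathcomp Require Import ring lra.
Set Implicit Arguments. Unset Strict Implicit. Unset Printing Implicit Defensive.
Import Order.TTheory GRing.Theory Num.Theory.
Import numFieldNormedType.Exports.
Local Open Scope classical_set_scope.
Local Open Scope ring_scope.

(** * Exponential bounds behind Bernstein's inequality *)

Lemma ge0_derive_ge0 {R : realType} (f f' : R -> R) :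
  (forall x : R, is_derive (x : R^o) (1 : R^o) f (f' x)) -> f 0 = 0 ->
  (forall x, 0 <= x -> 0 <= f' x) -> forall x, 0 <= x -> 0 <= f x.
Proof.
move=> df f0 f'0 x x0; rewrite -f0.
apply: (@ger0_derive1_ndecry _ f 0) => //.
- by move=> z; rewrite in_itv/= andbT => z0; rewrite derive1E derive_val f'0 ?ltW.
- apply: derivable_within_continuous => z _.
  exact: (@ex_derive _ _ _ _ _ _ _ (df z)).
Qed.

Lemma expR_ge_quadratic {R : realType} (y : R) :
  0 <= y -> 1 + y + y ^+ 2 / 2 <= expR y.
Proof.
move=> y0; rewrite -subr_ge0; move: y y0.
apply: (@ge0_derive_ge0 _ _ (fun x => expR x - (1 + x))).
- by move=> x; apply: is_derive_eq; rewrite /GRing.scale/=; field.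
- by rewrite expR0; field.
- by move=> x _; rewrite subr_ge0; exact: expR_ge1Dx.
Qed.

(** The right-hand side over [1 - y / 3] is the [2/1] Pade approximant of [expR]. The difference of
    the two sides and its derivative vanish at 0, and the second derivative is nonnegative because
    [1 - x <= expR (- x)]. *)
Lemma expR_le_rational {R : realType} (y : R) :
  0 <= y -> (1 - y / 3) * expR y <= 1 + 2 / 3 * y + y ^+ 2 / 6.
Proof.
move=> y0; rewrite -subr_ge0; move: y y0.
apply: (@ge0_derive_ge0 _ _ (fun x => 2 / 3 + x / 3 - (2 / 3 - x / 3) * expR x)).
- by move=> x; apply: is_derive_eq; rewrite /GRing.scale/=; field.
- by rewrite expR0; field.
apply: (@ge0_derive_ge0 _ _ (fun x => (1 - (1 - x) * expR x) / 3)).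
- by move=> x; apply: is_derive_eq; rewrite /GRing.scale/=; field.
- by rewrite expR0; field.
move=> x x0; rewrite divr_ge0// subr_ge0 -[leRHS](expRxMexpNx_1 x).
by rewrite mulrC ler_wpM2l ?expR_ge0//; exact: expR_ge1Dx.
Qed.

(** For [y >= 0], divide the rational bound by [1 - y / 3], then use [y <= l]. For [y < 0], invert
    the quadratic bound at [- y]: [(1 + y + y ^+ 2 / 2) * (1 - y + y ^+ 2 / 2) = 1 + y ^+ 4 / 4]. *)
Lemma expR_le_bernstein {R : realType} (y l : R) : y <= l -> 0 <= l < 3 ->
  expR y <= 1 + y + y ^+ 2 / (2 * (1 - l / 3)).
Proof.
move=> yl /andP[l0 l3].
have l3' : 0 < 1 - l / 3 by lra.
have [y0|y0] := leP 0 y.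
  have y3' : 0 < 1 - y / 3 by lra.
  apply: (@le_trans _ _ (1 + y + y ^+ 2 / (2 * (1 - y / 3)))).
    rewrite -(ler_pM2l y3') (le_trans (expR_le_rational y0))// le_eqVlt.
    by apply/orP; left; apply/eqP; field; lra.
  rewrite lerD2l ler_wpM2l ?sqr_ge0// lef_pV2 ?posrE; lra.
apply: (@le_trans _ _ (1 + y + y ^+ 2 / 2)); last first.
  rewrite lerD2l ler_wpM2l ?sqr_ge0// lef_pV2 ?posrE; lra.
have Ny0 : 0 <= - y by lra.
have := expR_ge_quadratic Ny0; rewrite sqrrN => quad.
rewrite -[y in expR y]opprK expRN -[leLHS]mul1r ler_pdivrMr ?expR_gt0//.
apply: le_trans (ler_wpM2l _ quad); last by nra.
rewrite [leRHS](_ : _ = 1 + y ^+ 4 / 4); last by field.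
by rewrite lerDl divr_ge0// exprn_even_ge0.
Qed.

(** The left side is a Bernoulli moment generating function. After centring, the exponents
    [(1 - p) * l] and [- (p * l)] are both at most [l]; averaging the previous bound cancels the
    linear terms and leaves the variance [p * (1 - p)]. *)
Lemma bernoulli_mgf_le {R : realType} (p l : R) : 0 <= p <= 1 -> 0 <= l < 3 ->
  1 + (expR l - 1) * p <=
  expR (l * p + p * (1 - p) * (l ^+ 2 / (2 * (1 - l / 3)))).
Proof.
move=> /andP[p0 p1] /andP[l0 l3].
set c := (2 * (1 - l / 3))^-1.
have lI : 0 <= l < 3 by rewrite l0.
have q1l : (1 - p) * l <= l by nra.
have Npl : - (p * l) <= l by nra.
have e1 := expR_le_bernstein q1l lI.
have e2 := expR_le_bernstein Npl lI.
rewrite -/c in e1 e2.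
rewrite expRD; apply: le_trans (ler_wpM2l (expR_ge0 _) (expR_ge1Dx _)).
rewrite -ler_pdivrMl ?expR_gt0// -expRN.
have -> : expR (- (l * p)) * (1 + (expR l - 1) * p) =
    (1 - p) * expR (- (p * l)) + p * expR ((1 - p) * l).
  have -> : (1 - p) * l = l - l * p by ring.
  by rewrite expRD (mulrC p l); ring.
apply: (@le_trans _ _ ((1 - p) * (1 - p * l + (- (p * l)) ^+ 2 * c)
   + p * (1 + (1 - p) * l + ((1 - p) * l) ^+ 2 * c))).
  by rewrite lerD// ler_wpM2l// subr_ge0.
by rewrite le_eqVlt; apply/orP; left; apply/eqP; ring.
Qed.

(** * Bernstein's inequality for independent indicators *)

(* Expanding one factor [1 + b 1_E] either drops [E] or moves it into the
   intersection over [s1], so induction on [s2] needs only product rules for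
   intersections. *)
Lemma integral_prod_indic d (T : measurableType d) (R : realType)
  (P : probability T R) (I : eqType) (E : I -> set T) (s1 s2 : seq I) (b : R) :
  (forall i, measurable (E i)) -> 0 <= b ->
  (forall s : seq I, uniq s -> {subset s <= s1 ++ s2} ->
     P (\big[setI/setT]_(i <- s) E i) = (\prod_(i <- s) P (E i))%E) ->
  uniq (s1 ++ s2) ->
  (\int[P]_w (\1_(\big[setI/setT]_(i <- s1) E i) w *
              \prod_(i <- s2) (1 + b * \1_(E i) w))%:E)%E =
  (\prod_(i <- s1) fine (P (E i)) * \prod_(i <- s2) (1 + b * fine (P (E i))))%:E.
Proof.
move=> mE b0; elim: s2 s1 => [|e s2 IH] s1 indep us.
  rewrite !cats0 in indep us.
  under eq_integral do rewrite big_nil mulr1.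
  rewrite integral_indic//; last exact: bigsetI_measurable.
  rewrite setIT big_nil mulr1 -prodEFin.
  apply: (etrans (indep _ us _)) => //.
  by apply: eq_bigr => i _; rewrite fineK// fin_num_measure.
have perm_s : perm_eq (rcons s1 e ++ s2) (s1 ++ e :: s2) by rewrite cat_rcons.
have mprod (l : seq I) : measurable_fun [set: T]
    (fun w => \prod_(i <- l) (1 + b * \1_(E i) w)).
  apply: measurable_prod => i _.
  apply: measurable_funD => //; apply: measurable_funM => //.
have mI (l : seq I) : measurable (\big[setI/setT]_(i <- l) E i).
  by apply: bigsetI_measurable.
have g0 (l1 l2 : seq I) w : 0 <= \1_(\big[setI/setT]_(i <- l1) E i) w *
              \prod_(i <- l2) (1 + b * \1_(E i) w) :> R.
  by rewrite mulr_ge0// prodr_ge0// => i _; rewrite addr_ge0// mulr_ge0.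
have mg (l1 l2 : seq I) : measurable_fun [set: T] (fun w =>
    (\1_(\big[setI/setT]_(i <- l1) E i) w *
              \prod_(i <- l2) (1 + b * \1_(E i) w))%:E : \bar R).
  by apply/measurable_EFinP; apply: measurable_funM.
under eq_integral => w _.
  rewrite big_cons [X in X%:E](_ : _ =
    \1_(\big[setI/setT]_(i <- s1) E i) w * \prod_(i <- s2) (1 + b * \1_(E i) w) +
    b * (\1_(\big[setI/setT]_(i <- rcons s1 e) E i) w *
         \prod_(i <- s2) (1 + b * \1_(E i) w))); last first.
    by rewrite big_rcons/= indicI/=; ring.
  rewrite EFinD.
  over.
rewrite ge0_integralD//=; last 3 first.
- by move=> w _; rewrite lee_fin.
- by move=> w _; rewrite lee_fin mulr_ge0.
- by under eq_fun do rewrite EFinM; exact: measurable_funeM.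
under [X in (_ + X)%E]eq_integral do rewrite EFinM.
rewrite ge0_integralZl_EFin//; last by move=> w _; rewrite lee_fin.
rewrite !IH//.
- by rewrite -EFinM -EFinD big_rcons big_cons; congr EFin => /=; ring.
- by move=> s us' /(_ _ _)ss; apply: indep => // i /ss; rewrite (perm_mem perm_s).
- by rewrite (perm_uniq perm_s).
- move=> s us' ss; apply: indep => // i /ss; rewrite !mem_cat inE.
  by case/orP => ->//; rewrite !orbT.
- move: us; rewrite !cat_uniq /= negb_or => /and3P[-> /andP[_ ->] /andP[_ ->]].
  by [].
Qed.
(** Chernoff's method: Markov's inequality for the exponential of [l] times the sum, whose
    expectation factors by independence. *)
Lemma sum_indic_bernstein d (T : measurableType d) (R : realType)
  (P : probability T R) (I : eqType) (E : I -> set T) (s : seq I) (V A : R) :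
  (forall i, measurable (E i)) ->
  (forall s' : seq I, uniq s' -> {subset s' <= s} ->
     P (\big[setI/setT]_(i <- s') E i) = (\prod_(i <- s') P (E i))%E) ->
  uniq s -> 0 < V -> 0 <= A ->
  \sum_(i <- s) fine (P (E i)) * (1 - fine (P (E i))) <= V ->
  (P [set w | (\sum_(i <- s) fine (P (E i)) + A <= \sum_(i <- s) \1_(E i) w)%R]
   <= (expR (- (A ^+ 2 / (2 * (V + A / 3)))))%:E)%E.
Proof.
move=> mE indep us V0 A0 hV.
set mu := \sum_(i <- s) fine (P (E i)).
set D := [set w | _].
(* With this [l], [1 - l / 3 = V / (V + A / 3)], so the exponent [- (l * A) + V * (l ^+ 2 / (2 * (1
   - l / 3)))] collapses to the stated one. *)
pose l := A / (V + A / 3).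
have VA0 : 0 < V + A / 3 by lra.
have l0 : 0 <= l by rewrite divr_ge0// ltW.
have l3 : l < 3 by rewrite ltr_pdivrMr//; lra.
have el0 : 0 <= expR l - 1 by rewrite subr_ge0 -expR0 ler_expR.
(* An indicator is 0 or 1, so its exponential is affine in it, which is the form that
   [integral_prod_indic] evaluates. *)
have prodE w : \prod_(i <- s) (1 + (expR l - 1) * \1_(E i) w) =
    expR (l * \sum_(i <- s) \1_(E i) w).
  rewrite mulr_sumr expR_sum; apply: eq_bigr => i _.
  by rewrite indicE; case: (_ \in _); rewrite ?mulr1 ?mulr0 ?addr0 ?expR0//; ring.
have mprod : measurable_fun [set: T]
    (fun w => \prod_(i <- s) (1 + (expR l - 1) * \1_(E i) w)).
  apply: measurable_prod => i _.
  by apply: measurable_funD => //; apply: measurable_funM.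
have mD : measurable D.
  have ms : measurable_fun [set: T] (fun w => \sum_(i <- s) \1_(E i) w : R).
    by apply: measurable_sum => i; exact: measurable_indic.
  have := ms measurableT _ (measurable_itv `[mu + A, +oo[); rewrite setTI.
  by congr measurable; apply/seteqP; split => w /=; rewrite in_itv/= andbT.
have p01 i : 0 <= fine (P (E i)) <= 1.
  rewrite fine_ge0//= -lee_fin fineK ?fin_num_measure//.
  exact: probability_le1.
have := @integral_prod_indic _ T R P I E [::] s _ mE el0 indep us.
rewrite !big_nil mul1r.
under eq_integral do rewrite indicT mul1r.
move=> int.
have markov : ((expR (l * (mu + A)))%:E * P D <=
    \int[P]_w (\prod_(i <- s) (1 + (expR l - 1) * \1_(E i) w))%:E)%E.
  have -> : P D = (\int[P]_w (\1_D w)%:E)%E by rewrite integral_indic// setIT.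
  rewrite -ge0_integralZl_EFin ?expR_ge0//; last first.
    by apply/measurable_EFinP.
  apply: ge0_le_integral => //.
  - by apply: measurable_funeM; apply/measurable_EFinP.
  - exact/measurable_EFinP.
  move=> w _; rewrite -EFinM lee_fin prodE indicE.
  have [wD|wD] := boolP (w \in D); last by rewrite mulr0 expR_ge0.
  by rewrite mulr1 ler_expR ler_wpM2l//; rewrite inE in wD.
have mgf : \prod_(i <- s) (1 + (expR l - 1) * fine (P (E i))) <=
    expR (l * mu + V * (l ^+ 2 / (2 * (1 - l / 3)))).
  have c0 : 0 <= l ^+ 2 / (2 * (1 - l / 3)).
    by rewrite divr_ge0 ?sqr_ge0// mulr_ge0// subr_ge0 ler_pdivrMr//; lra.
  apply: (@le_trans _ _ (\prod_(i <- s) expR (l * fine (P (E i)) +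
    fine (P (E i)) * (1 - fine (P (E i))) * (l ^+ 2 / (2 * (1 - l / 3)))))).
    apply: ler_prod => i _; rewrite bernoulli_mgf_le ?l0// andbT.
    by rewrite addr_ge0// mulr_ge0//; case/andP: (p01 i).
  rewrite -expR_sum ler_expR big_split/= -mulr_sumr -mulr_suml lerD2l.
  exact: ler_wpM2r.
move: markov; rewrite int -(fineK (fin_num_measure P D mD)) -EFinM !lee_fin.
move=> /le_trans/(_ mgf); rewrite -ler_pdivlMl ?expR_gt0// -expRN -expRD.
move=> /le_trans; apply; rewrite ler_expR le_eqVlt; apply/orP; left; apply/eqP.
by rewrite /l; field; lra.
Qed.

(* Chernoff at [a] only needs [a ^ 2 >= 2 (L / n) (q (1 - q) + D + a / 3)], and
   [q (1 - q) + D] dominates the average variance because a parabola lies below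
   its tangent line at [q]. *)
Lemma mean_indic_tail d (T : measurableType d) (R : realType)
  (P : probability T R) (I : eqType) (E : I -> set T) (s : seq I) (q L D : R) :
  (forall i, measurable (E i)) ->
  (forall s' : seq I, uniq s' -> {subset s' <= s} ->
     P (\big[setI/setT]_(i <- s') E i) = (\prod_(i <- s') P (E i))%E) ->
  uniq s -> (0 < size s)%N -> 0 < q < 1 -> 0 < L ->
  let n := (size s)%:R : R in
  let pbar := n^-1 * \sum_(i <- s) fine (P (E i)) in
  let a := D / 5 + Num.sqrt (2 * (q * (1 - q)) * L / n) + 16 / 5 * (L / n) in
  `|pbar - q| <= D ->
  (P [set w | (pbar + a <= n^-1 * \sum_(i <- s) \1_(E i) w)%R]
   <= (expR (- L))%:E)%E.
Proof.
move=> mE indep us s0 /andP[q0 q1] L0 n pbar a pD.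
have n0 : 0 < n by rewrite ltr0n.
have D0 : 0 <= D by apply: le_trans pD.
pose l := L / n; pose r := Num.sqrt (2 * (q * (1 - q)) * L / n).
have aE : a = D / 5 + r + 16 / 5 * l by [].
have l0 : 0 < l by rewrite divr_gt0.
have r0 : 0 <= r by exact: sqrtr_ge0.
have v0 : 0 < q * (1 - q) by rewrite mulr_gt0// subr_gt0.
have r2 : r ^+ 2 = 2 * (q * (1 - q)) * l.
  rewrite sqr_sqrtr /l ?mulrA//.
  by rewrite divr_ge0 ?(ltW n0)// mulr_ge0 ?(ltW L0)// !mulr_ge0// ltW// subr_gt0.
have a0 : 0 <= a.
  by rewrite aE !addr_ge0// mulr_ge0// ltW.
have key : 2 * l * (q * (1 - q) + D + a / 3) <= a ^+ 2.
  have Dr := mulr_ge0 D0 r0; have Dl := mulr_ge0 D0 (ltW l0).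
  have rl := mulr_ge0 r0 (ltW l0); have ll := mulr_ge0 (ltW l0) (ltW l0).
  (* In the expansion below, the only negative cross term is [- (64 / 75) * (D * l)]; this square
     absorbs it and leaves [32 / 9 * (l * l)]. *)
  have sq := sqr_ge0 (D / 5 - 32 / 15 * l).
  rewrite aE -subr_ge0.
  rewrite [leRHS](_ : _ = (D / 5 - 32 / 15 * l) ^+ 2 + 2 / 5 * (D * r)
    + 86 / 15 * (r * l) + 32 / 9 * (l * l) + (r ^+ 2 - 2 * (q * (1 - q)) * l)).
    by rewrite r2 subrr addr0; lra.
  by field.
have V0 : 0 < n * (q * (1 - q) + D) by rewrite mulr_gt0// ltr_wpDr.
have sumE : \sum_(i <- s) fine (P (E i)) = n * pbar.
  by rewrite /pbar mulVKf// gt_eqF.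
have varV : \sum_(i <- s) fine (P (E i)) * (1 - fine (P (E i))) <=
    n * (q * (1 - q) + D).
  apply: (@le_trans _ _ (\sum_(i <- s)
      (q * (1 - q) - (1 - 2 * q) * q + (1 - 2 * q) * fine (P (E i))))).
    apply: ler_sum => i _; rewrite -subr_ge0.
    rewrite [leRHS](_ : _ = (fine (P (E i)) - q) ^+ 2) ?sqr_ge0//; ring.
  rewrite big_split/= -mulr_sumr sumE big_const_seq count_predT iter_addr_0.
  rewrite -[X in X + _]mulr_natl -/n [X in _ + X]mulrCA -mulrDr ler_pM2l//.
  (* The slope [1 - 2 * q] has absolute value at most 1, so the tangent line costs at most [D]. *)
  have /andP[h1 h2] : - D <= pbar - q <= D by rewrite -ler_norml.
  nra.
have na0 : 0 <= n * a by rewrite mulr_ge0// ltW.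
have := sum_indic_bernstein mE indep us V0 na0 varV.
rewrite sumE -mulrDr.
rewrite (_ : [set w | _] = [set w | pbar + a <= n^-1 * \sum_(i <- s) \1_(E i) w]).
  move=> /le_trans; apply; rewrite lee_fin ler_expR lerN2.
  have W0 : 0 < q * (1 - q) + D + a / 3.
    by rewrite ltr_wpDr ?divr_ge0// ltr_wpDr.
  rewrite -mulrA -mulrDr ler_pdivlMr ?mulr_gt0//.
  have -> : L = n * l by rewrite /l mulrC divfK// gt_eqF.
  rewrite exprMn [leLHS](_ : _ = n ^+ 2 * (2 * l * (q * (1 - q) + D + a / 3))).
    by rewrite ler_pM2l ?exprn_gt0.
  by ring.
by apply/seteqP; split => w /=; rewrite ler_pdivlMl.
Qed.

(** * Windows as index lists, and the empirical CDF *)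

(** Flattening the double sum into one duplicate-free list makes the tail bounds for indicators
    apply to a whole window. *)
Definition window (B : nat -> nat) (t m : nat) : seq (nat * nat) :=
  [seq (j, l) | j <- index_iota (t - m).+1 t.+1, l <- index_iota 1 (B j).+1].

Lemma mem_window (B : nat -> nat) (t m : nat) (p : nat * nat) :
  (p \in window B t m) =
  ((t - m).+1 <= p.1 < t.+1)%N && (1 <= p.2 < (B p.1).+1)%N.
Proof.
case: p => j l; apply/allpairsPdep/andP => /=.
  by move=> [j' [l' [+ + [-> ->]]]]; rewrite !mem_index_iota.
by move=> [jt lB]; exists j, l; rewrite !mem_index_iota.
Qed.

Lemma window_uniq (B : nat -> nat) (t m : nat) : uniq (window B t m).
Proof.
apply: allpairs_uniq_dep; [exact: iota_uniq | by move=> *; exact: iota_uniq |].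
by move=> [j l] [j' l'] _ _ /= [-> ->].
Qed.

Lemma size_window (B : nat -> nat) (t m : nat) :
  size (window B t m) = Bsum B t m.
Proof.
rewrite size_allpairs_dep sumnE big_map /Bsum; apply: eq_bigr => j _.
by rewrite size_iota subn1.
Qed.

Lemma big_window (R : nmodType) (B : nat -> nat) (t m : nat) (f : nat -> nat -> R) :
  \sum_((t - m).+1 <= j < t.+1) \sum_(1 <= l < (B j).+1) f j l =
  \sum_(p <- window B t m) f p.1 p.2.
Proof. by rewrite big_allpairs_dep. Qed.

Lemma Fhat_window (R : realType) (T : Type) (B : nat -> nat)
  (u : nat -> nat -> T -> R) (t m : nat) (x : R) (w : T) :
  Fhat B u t m x w = (size (window B t m))%:R^-1 *
    \sum_(p <- window B t m) \1_(u p.1 p.2 @^-1` `]-oo, x]) w.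
Proof.
rewrite /Fhat big_window size_window; congr (_ * _); apply: eq_bigr => p _.
rewrite indicE; case: ifPn => up.
  by rewrite mem_set//= in_itv.
by rewrite memNset//= in_itv/=; apply/negP.
Qed.

Lemma size_window_gt0 (B : nat -> nat) (t m : nat) :
  (forall j, (1 <= j <= t)%N -> (1 <= B j)%N) -> (1 <= m <= t)%N ->
  (0 < size (window B t m))%N.
Proof.
move=> B1 /andP[m0 mt]; have t0 : (0 < t)%N := leq_trans m0 mt.
have : (t, 1%N) \in window B t m.
  by rewrite mem_window/= ltnSn !ltnS B1 ?t0 ?leqnn// ltn_subrL m0 t0.
by case: (window B t m).
Qed.

Lemma Fhat_homo (R : realType) (T : Type) (B : nat -> nat)
  (u : nat -> nat -> T -> R) (t m : nat) (w : T) :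
  {homo (fun x => Fhat B u t m x w) : x y / x <= y}.
Proof.
move=> x y xy; rewrite ler_wpM2l ?invr_ge0 ?ler0n//.
apply: ler_sum => j _; apply: ler_sum => l _.
case: ifPn => [ux|_]; last by case: ifP => _; rewrite ?ler01.
by rewrite (le_trans ux xy).
Qed.

Lemma Fhat_ge0 (R : realType) (T : Type) (B : nat -> nat)
  (u : nat -> nat -> T -> R) (t m : nat) (x : R) (w : T) :
  0 <= Fhat B u t m x w.
Proof.
rewrite mulr_ge0 ?invr_ge0 ?ler0n// sumr_ge0// => j _.
by rewrite sumr_ge0// => l _; case: ifP.
Qed.

Lemma Fhat_le1 (R : realType) (T : Type) (B : nat -> nat)
  (u : nat -> nat -> T -> R) (t m : nat) (x : R) (w : T) :
  Fhat B u t m x w <= 1.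
Proof.
(* On an empty window the inverse of the size 0 is 0 by convention, so [Fhat] is 0. *)
rewrite Fhat_window; have [->|s0] := eqVneq (size (window B t m)) 0%N.
  by rewrite invr0 mul0r.
rewrite ler_pdivrMl ?ltr0n ?lt0n// mulr1 -sum1_size natr_sum.
by apply: ler_sum => p _; rewrite indicE; case: (_ \in _).
Qed.

(** These two values make the set defining [qhat] bounded below and nonempty, so that its [inf] is a
    genuine infimum. *)
Lemma Fhat_extremes (R : realType) (T : Type) (B : nat -> nat)
  (u : nat -> nat -> T -> R) (t m : nat) (w : T) :
  (0 < size (window B t m))%N ->
  (exists x, Fhat B u t m x w = 0) /\ (exists x, Fhat B u t m x w = 1).
Proof.
move=> s0; pose M := \sum_(p <- window B t m) `|u p.1 p.2 w|.
have uM p : p \in window B t m -> `|u p.1 p.2 w| <= M.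
  by move=> pw; rewrite /M (big_rem p)//= lerDl sumr_ge0.
split.
  (* The extra [- 1] is there because a sample equal to [- M] would be counted at [- M]. *)
  exists (- M - 1); rewrite Fhat_window big_seq big1 ?mulr0// => p /uM.
  rewrite ler_norml => /andP[Mu _]; rewrite indicE memNset//= in_itv/=.
  by apply/negP; rewrite -ltNge; lra.
exists M; rewrite Fhat_window (eq_big_seq (fun=> 1)) => [|p /uM].
  by rewrite big_const_seq count_predT iter_addr_0 mulVf// pnatr_eq0 -lt0n.
by rewrite ler_norml => /andP[_ uM']; rewrite indicE mem_set//= in_itv.
Qed.

(** * Trapping the empirical quantile *)

Lemma qhat_le (R : realType) (T : Type) (alpha : R) (B : nat -> nat)
  (u : nat -> nat -> T -> R) (t m : nat) (x : R) (w : T) :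
  (0 < size (window B t m))%N -> alpha < 1 ->
  1 - alpha <= Fhat B u t m x w -> qhat alpha B u t m w <= x.
Proof.
move=> s0 a1 ax; apply: ge_inf => //=.
(* Since [0 < 1 - alpha], a point where [Fhat] vanishes is a lower bound of the set. *)
have [[y y0] _] := Fhat_extremes u w s0.
exists y => z /= az; rewrite leNgt; apply/negP => zy.
have := Fhat_homo B u t m w (ltW zy); rewrite y0; lra.
Qed.

Lemma le_qhat (R : realType) (T : Type) (alpha : R) (B : nat -> nat)
  (u : nat -> nat -> T -> R) (t m : nat) (x : R) (w : T) :
  (0 < size (window B t m))%N -> 0 < alpha ->
  Fhat B u t m x w < 1 - alpha -> x <= qhat alpha B u t m w.
Proof.
move=> s0 a0 xa; apply: lb_le_inf.
  have [_ [y y1]] := Fhat_extremes u w s0.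
  by exists y; rewrite /= y1; lra.
move=> z /= az; rewrite leNgt; apply/negP => zx.
have := Fhat_homo B u t m w (ltW zx); lra.
Qed.

(** * The mean CDF of a window *)

(** Each [F j] enters [B j] times, so this is the mean of [Fhat] at [x] when the samples of batch
    [j] have CDF [F j]. *)
Definition Fbar (R : realType) (B : nat -> nat) (F : nat -> R -> R)
  (t m : nat) (x : R) : R :=
  (size (window B t m))%:R^-1 * \sum_(p <- window B t m) F p.1 x.

Lemma cvg_sum_seq (R : realType) (U : Type) (G : set_system U) (FG : Filter G)
  (I : eqType) (s : seq I) (f : I -> U -> R) (l : I -> R) :
  (forall i, i \in s -> f i x @[x --> G] --> l i) ->
  \sum_(i <- s) f i x @[x --> G] --> \sum_(i <- s) l i.
Proof.
elim: s => [|i s IH] fl.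
  by under eq_fun do rewrite big_nil; rewrite big_nil; exact: cvg_cst.
under eq_fun do rewrite big_cons; rewrite big_cons.
apply: cvgD; first by apply: fl; rewrite mem_head.
by apply: IH => j js; apply: fl; rewrite inE js orbT.
Qed.

Lemma Fbar_surj (R : realType) (B : nat -> nat) (F : nat -> R -> R)
  (t m : nat) (v : R) :
  (0 < size (window B t m))%N ->
  (forall p, p \in window B t m ->
    [/\ continuous (F p.1), F p.1 x @[x --> -oo] --> (0 : R)
      & F p.1 x @[x --> +oo] --> (1 : R)]) ->
  0 < v < 1 -> exists x, Fbar B F t m x = v.
Proof.
move=> s0 hF /andP[v0 v1].
have cvgF (G : set_system R) (FG : Filter G) (l : R) :
    (forall p, p \in window B t m -> F p.1 x @[x --> G] --> l) ->
    Fbar B F t m x @[x --> G] --> l.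
  move=> Fl; rewrite (_ : l = (size (window B t m))%:R^-1 *
      \sum_(p <- window B t m) l).
    by apply: cvgM; [exact: cvg_cst | exact: cvg_sum_seq].
  rewrite big_const_seq count_predT iter_addr_0 -[l *+ _]mulr_natl mulKf//.
  by rewrite pnatr_eq0 -lt0n.
have Fb0 : Fbar B F t m x @[x --> -oo] --> (0 : R).
  by apply: cvgF => p /hF[].
have Fb1 : Fbar B F t m x @[x --> +oo] --> (1 : R).
  by apply: cvgF => p /hF[].
have cFb : continuous (Fbar B F t m).
  move=> x; apply: cvgM; first exact: cvg_cst.
  by apply: cvg_sum_seq => p /hF[cF _ _]; exact: cF.
(* The signs of [a] and of [b] below serve only to order the endpoints for the intermediate value
   theorem. *)
have [a [a0 av]] : exists a, a < 0 /\ Fbar B F t m a < v.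
  near (ninfty_nbhs R) => a; exists a; split; near: a.
    exact: nbhs_ninfty_lt.
  exact: (cvgr_lt _ Fb0).
have [b [b0 bv]] : exists b, 0 < b /\ v < Fbar B F t m b.
  near (pinfty_nbhs R) => b; exists b; split; near: b.
    exact: nbhs_pinfty_gt.
  exact: (cvgr_gt _ Fb1).
have ab : a <= b by lra.
have [|x _ xv] := IVT ab (continuous_subspaceT cFb) (v := v).
  by rewrite ge_min le_max (ltW av) (ltW bv) orbT.
by exists x.
Unshelve. all: by end_near. Qed.

(** * Deviation bounds for windows of samples *)

Section windows_of_samples.
Context (R : realType) (d : measure_display) (T : measurableType d)
  (P : probability T R) (t : nat) (alpha : R) (F : nat -> R -> R)
  (B : nat -> nat) (u : nat -> nat -> {RV P >-> R}) (delta : R).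
Context (alpha01 : 0 < alpha < 1)
  (cF : forall j, (1 <= j <= t)%N -> continuous (F j))
  (B1 : forall j, (1 <= j <= t)%N -> (1 <= B j)%N)
  (cdfF : forall j l, (1 <= j <= t)%N -> (1 <= l <= B j)%N ->
     forall x, cdf (u j l) x = (F j x)%:E)
  (indep : mutually_independent P
    [set p : nat * nat | (1 <= p.1 <= t)%N /\ (1 <= p.2 <= B p.1)%N]
    (fun p => (u p.1 p.2 : T -> R)))
  (delta01 : 0 < delta < 1).

Let v : nat -> nat -> T -> R := fun j l => u j l.

Let inw (m : nat) (p : nat * nat) : p \in window B t m ->
  (1 <= p.1 <= t)%N /\ (1 <= p.2 <= B p.1)%N.
Proof.
rewrite mem_window !ltnS => /andP[/andP[tp ->] ->]; split=> //.
by rewrite (leq_trans _ tp).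
Qed.

Let mpre (j l : nat) (C : set R) : measurable C -> measurable (u j l @^-1` C).
Proof. by move=> mC; exact: measurable_funPTI. Qed.

Let pre_le (j l : nat) (x : R) : (1 <= j <= t)%N -> (1 <= l <= B j)%N ->
  P (u j l @^-1` `]-oo, x]) = (F j x)%:E.
Proof. by move=> jt lB; rewrite -(cdfF jt lB). Qed.

Let pre_gt (j l : nat) (x : R) : (1 <= j <= t)%N -> (1 <= l <= B j)%N ->
  P (u j l @^-1` `]x, +oo[) = (1 - F j x)%:E.
Proof.
move=> jt lB.
have -> : u j l @^-1` `]x, +oo[ = ~` (u j l @^-1` `]-oo, x]).
  by rewrite -setCitvl.
rewrite probability_setC; last by apply: mpre; exact: measurable_itv.
by rewrite pre_le.
Qed.

(** Batch [j] is nonempty, so [F j] is the CDF of its first sample; the limits in [F_cvg] are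
    obtained in the same way. *)
Lemma F01 (j : nat) (x : R) : (1 <= j <= t)%N -> 0 <= F j x <= 1.
Proof.
move=> jt; have lB : (1 <= 1 <= B j)%N by rewrite B1.
by rewrite -!lee_fin -(cdfF jt lB) cdf_ge0 cdf_le1.
Qed.

Lemma F_cvg (j : nat) : (1 <= j <= t)%N ->
  F j x @[x --> -oo] --> (0 : R) /\ F j x @[x --> +oo] --> (1 : R).
Proof.
move=> jt; have lB : (1 <= 1 <= B j)%N by rewrite B1.
have cdfE : cdf (u j 1%N) = EFin \o F j by apply/funext => x; exact: (cdfF jt lB).
have := cvg_cdfNy0 (u j 1%N); have := cvg_cdfy1 (u j 1%N).
rewrite cdfE => h1 h0; split.
  exact: (@fine_cvg _ _ _ _ (EFin \o F j) 0 h0).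
exact: (@fine_cvg _ _ _ _ (EFin \o F j) 1 h1).
Qed.

(** The window [m] lies inside the window [k], so every term of the average is within [phi F t k] of
    [F t x]. *)
Lemma Fbar_sub_le_phi (m k : nat) (x : R) : (1 <= m <= k)%N -> (k <= t)%N ->
  `|Fbar B F t m x - F t x| <= phi F t k.
Proof.
move=> /andP[m1 mk] kt.
have s0 : (0 < size (window B t m))%N.
  by apply: size_window_gt0 => //; rewrite m1 (leq_trans mk).
have n0 : 0 < (size (window B t m))%:R :> R by rewrite ltr0n.
have t0 : (1 <= t <= t)%N by rewrite leqnn (leq_trans m1)// (leq_trans mk).
rewrite /Fbar -(ler_pM2l n0) -{1}(gtr0_norm n0) -normrM mulrBr mulVKf ?gt_eqF//.
have -> : (size (window B t m))%:R * F t x = \sum_(p <- window B t m) F t x.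
  by rewrite big_const_seq count_predT iter_addr_0 mulr_natl.
rewrite -sumrB (le_trans (ler_norm_sum _ _ _))//.
apply: (@le_trans _ _ (\sum_(p <- window B t m) phi F t k)); last first.
  by rewrite big_const_seq count_predT iter_addr_0 mulr_natl.
rewrite big_seq [leRHS]big_seq; apply: ler_sum => p pw.
have [pt _] := inw pw.
apply: (@le_trans _ _ (supnorm (fun y => F p.1 y - F t y))).
  apply: ub_le_sup => /=; last by exists x.
  (* A difference of two CDFs is at most 1 in absolute value, so the [sup] in [supnorm] is over a
     bounded set. *)
  exists 1 => _ [y _ <-].
  by have := F01 y pt; have := F01 y t0; rewrite ler_norml; lra.
rewrite /phi; apply: (@le_bigmax_seq _ _ _ _ _ p.1 xpredT
  (fun j => supnorm (fun y => F j y - F t y))) => //.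
rewrite mem_index_iota; move: pw; rewrite mem_window => /andP[/andP[tp ->] _].
by rewrite andbT (leq_trans _ tp)// ltnS leq_sub2l.
Qed.

(** This is [ln (4 / delta)]: each of the four tail events gets probability at most
    [expR (- L) = delta / 4]. *)
Let L := ln (2 / (delta / 2)).

Let L0 : 0 < L.
Proof. by move: delta01 => /andP[d0 d1]; rewrite ln_gt0// ltr_pdivlMr; lra. Qed.

Let expNL : expR (- L) = delta / 4.
Proof.
move: delta01 => /andP[d0 d1].
by rewrite expRN lnK ?posrE ?divr_gt0//; field; lra.
Qed.

Lemma psi_ge0 (m : nat) : 0 <= psi alpha B t m (delta / 2).
Proof.
by rewrite /psi -/L addr_ge0// divr_ge0 ?ler0n// mulr_ge0// ltW.
Qed.

(** The right side is the deviation of [mean_indic_tail] without its [D / 5]; hence the factor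
    [4 / 5]. *)
Let psiE (m : nat) : 4 / 5 * psi alpha B t m (delta / 2) =
  Num.sqrt (2 * (alpha * (1 - alpha)) * L / (size (window B t m))%:R)
  + 16 / 5 * (L / (size (window B t m))%:R).
Proof.
rewrite /psi -/L size_window mulrDr -!mulrA; congr (_ + _); last by lra.
by rewrite !mulrA [X in X * _](_ : _ = 1) ?mul1r//; field.
Qed.

(** Stated for a general [C] to serve both tails: [q] is [1 - alpha] for the samples at most [x] and
    [alpha] for those above, with the same variance. *)
Let window_tail (C : set R) (m : nat) (q D : R) :
  measurable C -> (1 <= m <= t)%N -> q * (1 - q) = alpha * (1 - alpha) ->
  0 < q < 1 ->
  let n := (size (window B t m))%:R : R in
  let pbar := n^-1 * \sum_(p <- window B t m) fine (P (u p.1 p.2 @^-1` C)) in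
  `|pbar - q| <= D ->
  (P [set w | (pbar + (D / 5 + 4 / 5 * psi alpha B t m (delta / 2)) <=
       n^-1 * \sum_(p <- window B t m) \1_(u p.1 p.2 @^-1` C) w)%R]
   <= (delta / 4)%:E)%E.
Proof.
move=> mC mt qE q01 n pbar pD; rewrite -expNL.
have := @mean_indic_tail _ T R P _ (fun p => u p.1 p.2 @^-1` C)
  (window B t m) q L D.
rewrite psiE [D / 5 + _]addrA -qE; apply => //.
- by move=> p; exact: mpre.
- by move=> s us sw; apply: (indep (A := fun=> C)) => // p /sw /inw.
- exact: window_uniq.
- exact: size_window_gt0.
Qed.

Let mFhat (m : nat) (x : R) : measurable_fun [set: T] (Fhat B v t m x).
Proof.
rewrite (_ : Fhat _ _ _ _ _ = fun w => (size (window B t m))%:R^-1 *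
  \sum_(p <- window B t m) \1_(v p.1 p.2 @^-1` `]-oo, x]) w).
  apply: measurable_funM => //; apply: measurable_sum => p.
  by apply: measurable_indic; apply: mpre; exact: measurable_itv.
by apply/funext => w; rewrite Fhat_window.
Qed.

Lemma Fhat_upper_tail (m : nat) (x D : R) : (1 <= m <= t)%N ->
  `|Fbar B F t m x - (1 - alpha)| <= D ->
  let A := [set w | Fbar B F t m x + (D / 5 + 4 / 5 * psi alpha B t m (delta / 2))
                    <= Fhat B v t m x w] in
  measurable A /\ (P A <= (delta / 4)%:E)%E.
Proof.
move=> mt FD A; split.
  have := mFhat m x measurableT (measurable_itv
    `[Fbar B F t m x + (D / 5 + 4 / 5 * psi alpha B t m (delta / 2)), +oo[).
  by rewrite setTI; congr measurable; apply/seteqP; split => w;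
    rewrite /A /= in_itv/= andbT.
have FbE : Fbar B F t m x = (size (window B t m))%:R^-1 *
    \sum_(p <- window B t m) fine (P (u p.1 p.2 @^-1` `]-oo, x])).
  congr (_ * _); apply: eq_big_seq => p /inw[p1 p2]; by rewrite pre_le.
have := @window_tail `]-oo, x] m (1 - alpha) D.
rewrite /= -FbE => /(_ _ mt _ _ FD) tail.
rewrite /A; under eq_set do rewrite Fhat_window.
by apply: tail => //; [ring | move: alpha01; lra].
Qed.

(** The lower tail of [Fhat] is the upper tail of [1 - Fhat], the fraction of samples above [x]. *)
Lemma Fhat_lower_tail (m : nat) (x D : R) : (1 <= m <= t)%N ->
  `|Fbar B F t m x - (1 - alpha)| <= D ->
  let A := [set w | Fhat B v t m x w <=
     Fbar B F t m x - (D / 5 + 4 / 5 * psi alpha B t m (delta / 2))] in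
  measurable A /\ (P A <= (delta / 4)%:E)%E.
Proof.
move=> mt FD A; split.
  have := mFhat m x measurableT (measurable_itv
    `]-oo, Fbar B F t m x - (D / 5 + 4 / 5 * psi alpha B t m (delta / 2))]).
  by rewrite setTI; congr measurable; apply/seteqP; split => w;
    rewrite /A /= in_itv.
have n0 : (size (window B t m))%:R != 0 :> R.
  by rewrite pnatr_eq0 -lt0n; exact: size_window_gt0.
have FbE : 1 - Fbar B F t m x = (size (window B t m))%:R^-1 *
    \sum_(p <- window B t m) fine (P (u p.1 p.2 @^-1` `]x, +oo[)).
  rewrite (eq_big_seq (fun p => 1 - F p.1 x)) => [|p /inw[p1 p2]].
    rewrite sumrB mulrBr big_const_seq count_predT iter_addr_0.
    by rewrite mulVf.
  by rewrite pre_gt.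
have FhE w : 1 - Fhat B v t m x w = (size (window B t m))%:R^-1 *
    \sum_(p <- window B t m) \1_(u p.1 p.2 @^-1` `]x, +oo[) w.
  rewrite Fhat_window [in RHS](eq_big_seq (fun p =>
    1 - \1_(v p.1 p.2 @^-1` `]-oo, x]) w)) => [|p _].
    rewrite sumrB mulrBr big_const_seq count_predT iter_addr_0.
    by rewrite mulVf.
  have -> : u p.1 p.2 @^-1` `]x, +oo[ = ~` (u p.1 p.2 @^-1` `]-oo, x]).
    by rewrite -setCitvl.
  by rewrite !indicE in_setC; case: (_ \in _); rewrite ?subr0 ?subrr.
have := @window_tail `]x, +oo[ m alpha D.
rewrite /= -FbE => /(_ _ mt erefl alpha01) tail.
rewrite (_ : A = [set w |
  1 - Fbar B F t m x + (D / 5 + 4 / 5 * psi alpha B t m (delta / 2)) <=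
  1 - Fhat B v t m x w]); last first.
  by apply/seteqP; split => w; rewrite /A/=; lra.
under eq_set do rewrite FhE.
apply: tail => //.
by rewrite (_ : _ - alpha = - (Fbar B F t m x - (1 - alpha))) ?normrN//; ring.
Qed.

Let Fbar_at (k : nat) (c : R) : (1 <= k <= t)%N -> 0 < c < 1 ->
  exists x, Fbar B F t k x = c.
Proof.
move=> kt c01; apply: Fbar_surj => //; first exact: size_window_gt0.
by move=> p /inw[p1 _]; have [] := F_cvg p1; split=> //; exact: cF.
Qed.

(** Triangle inequality through [F t x]: each of the two window means is within [phi F t k] of
    it. *)
Let Fbar_dist (i k : nat) (x e : R) : (1 <= i <= k)%N -> (k <= t)%N ->
  `|Fbar B F t k x - (1 - alpha)| <= e ->
  `|Fbar B F t i x - (1 - alpha)| <= e + 2 * phi F t k.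
Proof.
move=> /andP[i1 ik] kt ke.
have ikt : (1 <= i <= k)%N by rewrite i1.
have kkt : (1 <= k <= k)%N by rewrite leqnn (leq_trans i1).
have := Fbar_sub_le_phi x ikt kt; have := Fbar_sub_le_phi x kkt kt.
by move: ke; rewrite !ler_norml; lra.
Qed.

Let P_setU (A1 A2 : set T) : measurable A1 -> measurable A2 ->
  (P A1 <= (delta / 4)%:E)%E -> (P A2 <= (delta / 4)%:E)%E ->
  (P (A1 `|` A2) <= (delta / 2)%:E)%E.
Proof.
move=> mA1 mA2 PA1 PA2; apply: (le_trans (measureU2 _ _ _)) => //.
rewrite (_ : delta / 2 = delta / 4 + delta / 4); last by field.
by rewrite EFinD; exact: leeD.
Qed.

Let bound (i k : nat) : R := 12 / 5 * phi F t k
  + 6 / 5 * psi alpha B t k (delta / 2) + 4 / 5 * psi alpha B t i (delta / 2).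

Let eps_le_bound (i k : nat) : (1 <= k <= t)%N ->
  psi alpha B t k (delta / 2) <= bound i k.
Proof.
move=> /andP[k1 kt].
have kk : (1 <= k <= k)%N by rewrite k1 leqnn.
have phi0 := le_trans (normr_ge0 _) (Fbar_sub_le_phi 0 kk kt).
by have := psi_ge0 i; have := psi_ge0 k; rewrite /bound; lra.
Qed.

(** * One-sided bounds at the random quantile *)

Lemma Fhat_qhat_upper (i k : nat) : (1 <= i <= k)%N -> (k <= t)%N ->
  exists A : set T, [/\ measurable A, (P A <= (delta / 2)%:E)%E &
    forall w, ~ A w ->
      Fhat B v t i (qhat alpha B v t k w) w - (1 - alpha) <= bound i k].
Proof.
move=> /andP[i1 ik] kt; move: alpha01 => /andP[a0 a1].
have k1t : (1 <= k <= t)%N by rewrite kt (leq_trans i1).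
have i1t : (1 <= i <= t)%N by rewrite i1 (leq_trans ik).
set e := psi alpha B t k (delta / 2).
have e0 : 0 <= e := psi_ge0 k.
have eb : e <= bound i k := eps_le_bound i k1t.
(* If [alpha <= e], the level [1 - alpha + e] is at least 1; then [Fhat <= 1] suffices, as the bound
   is at least [alpha], and no event is discarded. *)
have [ea|ea] := leP alpha e.
  exists set0; split=> //.
    by rewrite measure0 lee_fin divr_ge0//; case/andP: delta01 => /ltW.
  by move=> w _; have := Fhat_le1 B v t i (qhat alpha B v t k w) w; lra.
have [|x xe] := @Fbar_at k (1 - alpha + e) k1t; first by lra.
have xk : `|Fbar B F t k x - (1 - alpha)| <= e by rewrite xe addrC addKr ger0_norm.
have xi := Fbar_dist (introT andP (conj i1 ik)) kt xk.
have [mA1 PA1] := Fhat_lower_tail k1t xk.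
have [mA2 PA2] := Fhat_upper_tail i1t xi.
eexists; split; [exact: (measurableU _ _ mA1 mA2) | exact: P_setU |].
move=> w /not_orP[/negP + /negP]; rewrite -!ltNge => A1 A2.
(* Off the first event, [Fhat] over the window [k] at [x] exceeds [1 - alpha + e - (e / 5 + 4 / 5 *
   e) = 1 - alpha]. *)
have qx : qhat alpha B v t k w <= x.
  by apply: qhat_le => //; [exact: size_window_gt0 | rewrite xe -/e in A1; lra].
have := Fhat_homo B v t i w qx.
(* With [D = e + 2 * phi F t k], the bias [D] and the deviation [D / 5] add up to [6 / 5 * D], which
   gives the coefficients [12 / 5] and [6 / 5]. *)
move: xi; rewrite ler_norml => /andP[_ xi].
by rewrite /bound -/e; lra.
Qed.

Lemma Fhat_qhat_lower (i k : nat) : (1 <= i <= k)%N -> (k <= t)%N ->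
  exists A : set T, [/\ measurable A, (P A <= (delta / 2)%:E)%E &
    forall w, ~ A w ->
      - bound i k <= Fhat B v t i (qhat alpha B v t k w) w - (1 - alpha)].
Proof.
move=> /andP[i1 ik] kt; move: alpha01 => /andP[a0 a1].
have k1t : (1 <= k <= t)%N by rewrite kt (leq_trans i1).
have i1t : (1 <= i <= t)%N by rewrite i1 (leq_trans ik).
set e := psi alpha B t k (delta / 2).
have e0 : 0 <= e := psi_ge0 k.
have eb : e <= bound i k := eps_le_bound i k1t.
(* Here the level [1 - alpha - e] is at most 0, and [0 <= Fhat] suffices. *)
have [ea|ea] := leP (1 - alpha) e.
  exists set0; split=> //.
    by rewrite measure0 lee_fin divr_ge0//; case/andP: delta01 => /ltW.
  by move=> w _; have := Fhat_ge0 B v t i (qhat alpha B v t k w) w; lra.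
have [|x xe] := @Fbar_at k (1 - alpha - e) k1t; first by lra.
have xk : `|Fbar B F t k x - (1 - alpha)| <= e.
  by rewrite xe addrC addKr normrN ger0_norm.
have xi := Fbar_dist (introT andP (conj i1 ik)) kt xk.
have [mA1 PA1] := Fhat_upper_tail k1t xk.
have [mA2 PA2] := Fhat_lower_tail i1t xi.
eexists; split; [exact: (measurableU _ _ mA1 mA2) | exact: P_setU |].
move=> w /not_orP[/negP + /negP]; rewrite -!ltNge => A1 A2.
(* Symmetrically, [Fhat] over the window [k] at [x] is strictly below [1 - alpha], as [le_qhat]
   requires. *)
have xq : x <= qhat alpha B v t k w.
  by apply: le_qhat => //; [exact: size_window_gt0 | rewrite xe -/e in A1; lra].
have := Fhat_homo B v t i w xq.
move: xi; rewrite ler_norml => /andP[xi _].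
by rewrite /bound -/e; lra.
Qed.

End windows_of_samples.

Theorem theorem2 (R : realType) (d : measure_display) (T : measurableType d)
  (P : probability T R) (t : nat) (alpha : R) (F : nat -> R -> R)
  (B : nat -> nat) (u : nat -> nat -> {RV P >-> R}) (i k : nat) (delta : R) :
  (0 < t)%N ->
  0 < alpha < 1 ->
  (forall j, (1 <= j <= t)%N -> continuous (F j)) ->
  (forall j, (1 <= j <= t)%N -> (1 <= B j)%N) ->
  (forall j l, (1 <= j <= t)%N -> (1 <= l <= B j)%N ->
     forall x, cdf (u j l) x = (F j x)%:E) ->
  mutually_independent P
    [set p : nat * nat | (1 <= p.1 <= t)%N /\ (1 <= p.2 <= B p.1)%N]
    (fun p => (u p.1 p.2 : T -> R)) ->
  (1 <= i <= k)%N -> (k <= t)%N ->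
  0 < delta < 1 ->
  exists A : set T, measurable A /\
    A `<=` [set w | `|Fhat B (fun j l => (u j l : T -> R)) t i
                        (qhat alpha B (fun j l => (u j l : T -> R)) t k w) w
                      - (1 - alpha)|
                    <= 12 / 5 * phi F t k
                       + 6 / 5 * psi alpha B t k (delta / 2)
                       + 4 / 5 * psi alpha B t i (delta / 2)] /\
    ((1 - delta)%:E <= P A)%E.
Proof.
move=> t0 alpha01 cF B1 cdfF indep ik kt delta01.
have [A1 [mA1 PA1 hA1]] := Fhat_qhat_upper alpha01 cF B1 cdfF indep delta01 ik kt.
have [A2 [mA2 PA2 hA2]] := Fhat_qhat_lower alpha01 cF B1 cdfF indep delta01 ik kt.
(* Each one-sided bound discards probability at most [delta / 2]; the complement is measurable
   because the discarded events involve only deterministic points. *)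
exists (~` (A1 `|` A2)); split; first by apply: measurableC; exact: measurableU.
split.
  move=> w /not_orP[/hA1 up /hA2 lo] /=.
  by rewrite ler_norml lo up.
rewrite probability_setC; last exact: measurableU.
have PU : (P (A1 `|` A2) <= delta%:E)%E.
  apply: (le_trans (measureU2 _ _ _)) => //.
  rewrite (_ : delta = delta / 2 + delta / 2); last by field.
  by rewrite EFinD; exact: leeD.
by rewrite EFinB leeB.
Qed.
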